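(* Let $(M,g)$ be a compact Riemannian manifold without boundary with volume measure $\mu_g$, and let $\phi^G$ be an Onsager operator on its density manifold $P_+^\infty(M)$. Let $\rho\in P_+^\infty(M)$ and $a\in S_0^\infty(M)$. For any $f\in C^\infty(M)$ with $a=\phi^G_\rho([f])$, the $G$-dual geodesic $\gamma$ satisfying $\gamma(0)=\rho$ and $\dot\gamma(0)=a$ is (on its interval of existence) the $G$-gradient flow, starting at $\rho$, of the potential energy $$\mathcal{F}\colon P_+^\infty(M)\to\mathbb{R},\qquad \mathcal{F}(\rho)=-\mathbb{E}_\rho[f]=-\int_M f\rho\,d\mu_g .$$
   Context: $P_+^\infty(M)=\{\rho\in C^\infty(M):\rho>0,\ \int_M\rho\,d\mu_g=1\}$ is a Fréchet manifold with tangent space $S_0^\infty(M)=\{a\in C^\infty(M):\int_M a\,d\mu_g=0\}$ and cotangent space (by definition) $C^\infty(M)/\mathbb{R}$ (smooth functions modulo constants; $[f]$ is the class of $f$), at every point. An Onsager operator is a family of linear, $L^2(M;\mu_g)$-selfadjoint, positive definite operators $\phi^G_\rho\colon C^\infty(M)/\mathbb{R}\to S_0^\infty(M)$, $\rho\in P_+^\infty(M)$, which are invertible. $G$-dual geodesic: the $G$-dual geodesic with $\gamma(0)=\rho$, $\dot\gamma(0)=a$ is the curve in $P_+^\infty(M)$ solving, on its interval of existence, $$\dot\gamma(t)=\phi^G_{\gamma(t)}\big((\phi^G_\rho)^{-1}(a)\big),\qquad \gamma(0)=\rho .$$ First variation: for $E\colon P_+^\infty(M)\to\mathbb{R}$,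 $\delta E(\rho)=[f_\rho]\in C^\infty(M)/\mathbb{R}$ is defined by $\langle f_\rho,\sigma\rangle_{L^2(M;\mu_g)}=\frac{d}{dt}\big|_{t=0}E(\rho+t\sigma)$ for all $\sigma\in S_0^\infty(M)$ (for which $\rho+t\sigma\in P_+^\infty(M)$ for small $t$). The $G$-gradient is $\operatorname{grad}^G_\rho(E)=\phi^G_\rho(\delta E(\rho))$. A $G$-gradient flow of $E$ is a curve $\rho(t)$ with $\dot\rho(t)=-\operatorname{grad}^G_{\rho(t)}(E)$. *)

(* Defs.v *)
From HB Require Import structures.
From mathcomp Require Import all_boot all_order all_algebra.
From mathcomp Require Import generic_quotient ring_quotient.
From mathcomp Require Import all_classical all_reals all_analysis.

Set Implicit Arguments.
Unset Strict Implicit.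
Unset Printing Implicit Defensive.

Import Order.TTheory GRing.Theory Num.Theory.
Import numFieldNormedType.Exports.

Local Open Scope classical_set_scope.
Local Open Scope ring_scope.

Lemma near_eq_continuous (T U : topologicalType) (f h : T -> U) x :
  {near x, f =1 h} -> {for x, continuous f} -> {for x, continuous h}.
Proof.
move=> fh cf; rewrite /prop_for /continuous_at -(nbhs_singleton fh).
by apply: cvg_trans cf; exact: near_eq_cvg.
Qed.

(** * Calculus on open subsets of [R^n] *)

Section Euclidean.
Context {R : realType} {n : nat}.
Implicit Types (f : 'rV[R]_n -> R) (s : seq 'I_n) (U : set 'rV[R]_n).

Definition partials s f : 'rV[R]_n -> R :=
  foldr (fun i h => 'D_(delta_mx 0 i) h) f s.

(* Meant for open [U]: all iterated partial derivatives exist and are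
   continuous on [U]. *)
Definition smooth_on U f : Prop :=
  forall s x, U x ->
    {for x, continuous (partials s f)} /\
    forall i, derivable (partials s f) x (delta_mx 0 i).

Lemma partials_lin U f h (k : R) s x : open U ->
  smooth_on U f -> smooth_on U h -> U x ->
  partials s (k *: f + h) x = k * partials s f x + partials s h x.
Proof.
move=> oU sf sh; elim: s x => [|i s IH] x Ux //=.
have -> : 'D_(delta_mx 0 i) (partials s (k *: f + h)) x =
          'D_(delta_mx 0 i) (k *: partials s f + partials s h) x.
  apply: near_eq_derive.
  have := open_nbhs_nbhs (conj oU Ux); apply: filterS => y Uy.
  by rewrite IH.
have [_ /(_ i) df] := sf s x Ux; have [_ /(_ i) dh] := sh s x Ux.
by rewrite deriveD ?deriveZ //; exact: derivableZ.
Qed.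

Lemma smooth_on_lin U f h (k : R) : open U ->
  smooth_on U f -> smooth_on U h -> smooth_on U (k *: f + h).
Proof.
move=> oU sf sh s x Ux.
have e : \forall y \near x,
    (k *: partials s f + partials s h) y = partials s (k *: f + h) y.
  have := open_nbhs_nbhs (conj oU Ux); apply: filterS => y Uy.
  by rewrite (partials_lin k s oU sf sh Uy).
have [cf df] := sf s x Ux; have [ch dh] := sh s x Ux; split.
  apply: (near_eq_continuous e).
  by apply: continuousD => //; exact: (@continuousZl_tmp _ _ _ _ k).
move=> i; apply: (near_eq_derivable e).
by apply: derivableD => //; exact: derivableZ.
Qed.

Lemma smooth_on_cst U (c : R) : smooth_on U (cst c).
Proof.
move=> s x _.
have [d ->] : exists d : R, partials s (cst c) = cst d.
  elim: s => [|i s [d IH]]; first by exists c.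
  by exists 0; rewrite /= IH; apply/funext => y; rewrite derive_cst.
by split=> [|i]; [exact: cst_continuous | exact: derivable_cst].
Qed.

End Euclidean.

(* The Lebesgue integral over [R^n] of a nonnegative Borel function, as an
   iterated one-dimensional integral (Tonelli). *)
Fixpoint lebesgue_int {R : realType} (n : nat) :
    ('rV[R]_n -> \bar R) -> \bar R :=
  match n with
  | 0 => fun F => F 0
  | n'.+1 => fun F =>
      (\int[lebesgue_measure]_(x in [set: R])
         lebesgue_int (fun y : 'rV[R]_n' => F (row_mx (x%:M : 'rV_1) y)))%E
  end.

(** * Smooth manifolds and Riemannian metrics *)

Record chart (R : realType) (n : nat) (M : topologicalType) := Chart {
  chart_dom : set M;
  chart_map :> M -> 'rV[R]_n;
  chart_inv : 'rV[R]_n -> M;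
  open_chart_dom : open chart_dom;
  open_chart_cod : open (chart_map @` chart_dom);
  chart_mapK : forall p, chart_dom p -> chart_inv (chart_map p) = p;
  chart_map_continuous :
    forall p, chart_dom p -> {for p, continuous chart_map};
  chart_inv_continuous :
    forall x, (chart_map @` chart_dom) x -> {for x, continuous chart_inv}
}.

Definition chart_cod R n M (c : chart R n M) : set 'rV[R]_n :=
  c @` chart_dom c.

(* The change of coordinates from [c] to [d] and its domain. *)
Definition transition R n M (c d : chart R n M) : 'rV[R]_n -> 'rV[R]_n :=
  d \o chart_inv c.

Definition overlap R n M (c d : chart R n M) : set 'rV[R]_n :=
  chart_cod c `&` chart_inv c @^-1` chart_dom d.

Record smooth_atlas (R : realType) (n : nat) (M : topologicalType) :=
  SmoothAtlas {
    atlas_index : Type;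
    atlas_chart :> atlas_index -> chart R n M;
    atlas_cover : forall p, exists i, chart_dom (atlas_chart i) p;
    atlas_smooth : forall i j (k : 'I_n),
      smooth_on (overlap (atlas_chart i) (atlas_chart j))
        (fun x => transition (atlas_chart i) (atlas_chart j) x 0 k)
  }.

(* A Riemannian metric given by its Gram matrices in the charts.  For row
   vectors the differential of [F] at [x] is [v |-> v *m 'J F x], whence the
   shape of the transformation rule. *)
Record riemannian_metric (R : realType) (n : nat) (M : topologicalType)
    (A : smooth_atlas R n M) := RiemannianMetric {
  gram :> atlas_index A -> 'rV[R]_n -> 'M[R]_n;
  gram_smooth : forall i (k l : 'I_n),
    smooth_on (chart_cod (A i)) (fun x => gram i x k l);
  gram_sym : forall i x, chart_cod (A i) x -> (gram i x)^T = gram i x;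
  gram_posdef : forall i x (v : 'rV[R]_n), chart_cod (A i) x -> v != 0 ->
    0 < (v *m gram i x *m v^T) 0 0;
  gram_transition : forall i j x, overlap (A i) (A j) x ->
    let T := transition (A i) (A j) in
    gram i x = 'J T x *m gram j (T x) *m ('J T x)^T
}.

Notation borel M := (g_sigma_algebraType (@open M)).

(* The Borel measure [mu] is the Riemannian volume: in every chart it has
   density [sqrt (det g)] with respect to Lebesgue measure. *)
Definition is_volume_measure (R : realType) n (M : ptopologicalType)
    (A : smooth_atlas R n M) (g : riemannian_metric A)
    (mu : {measure set (borel M) -> \bar R}) : Prop :=
  forall i (B : set (borel M)), measurable B -> B `<=` chart_dom (A i) ->
    mu B = lebesgue_int
      (fun x => (\1_(A i @` B) x * Num.sqrt (\det (g i x)))%:E).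

(** * The space of smooth functions *)

Section SmoothFunctions.
Context {R : realType} {n : nat} {M : topologicalType}.
Variable A : smooth_atlas R n M.

Definition smooth_fct : {pred M -> R} := fun f =>
  `[< forall i, smooth_on (chart_cod (A i)) (f \o chart_inv (A i)) >].

Lemma smooth_fct_submod : submod_closed smooth_fct.
Proof.
split=> [|k f h /asboolP sf /asboolP sh]; apply/asboolP => i.
  exact: (@smooth_on_cst _ _ _ 0).
exact: (smooth_on_lin k (@open_chart_cod _ _ _ (A i)) (sf i) (sh i)).
Qed.

HB.instance Definition _ :=
  GRing.isSubmodClosed.Build R (M -> R) smooth_fct smooth_fct_submod.

Record smooth := Smooth {
  smooth_val :> M -> R;
  smooth_valP : smooth_val \in smooth_fct
}.

HB.instance Definition _ := [isSub for smooth_val].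
HB.instance Definition _ := [Choice of smooth by <:].
HB.instance Definition _ := [SubChoice_isSubLmodule of smooth by <:].

(* Convergence in the Frechet topology of [C^oo(M)]: uniform convergence of
   all partial derivatives on compact sets, in every chart. *)
Definition smooth_cvg {T : Type} (F : set_system T) (u : T -> smooth)
    (l : smooth) : Prop :=
  forall i (s : seq 'I_n) (K : set 'rV[R]_n),
    compact K -> K `<=` chart_cod (A i) ->
    {uniform K, (fun t => partials s (u t \o chart_inv (A i))) @ F -->
                partials s (l \o chart_inv (A i))}.

(** * The quotient of smooth functions by constants *)

Definition constants : {pred smooth} := fun f =>
  `[< exists c : R, forall p, f p = c >].

Lemma constants_submod : submod_closed constants.
Proof.
split=> [|k f h /asboolP[c fc] /asboolP[d hd]]; apply/asboolP.
  by exists 0.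
by exists (k * c + d) => p; rewrite -(fc p) -(hd p).
Qed.

HB.instance Definition _ :=
  GRing.isSubmodClosed.Build R smooth constants constants_submod.

Definition smooth_mod := Quotient.quot constants.

HB.instance Definition _ := GRing.Zmodule.on smooth_mod.

Definition cls (f : smooth) : smooth_mod := \pi_(smooth_mod)%qT f.

Lemma cls_eqP f h : cls f = cls h <-> exists c : R, forall p, f p - h p = c.
Proof.
rewrite /cls; split => [/eqP|[c fh]].
  by rewrite -Quotient.idealrBE => /asboolP.
by apply/eqP; rewrite -Quotient.idealrBE; apply/asboolP; exists c.
Qed.

Lemma cls_is_zmod_morphism : zmod_morphism cls.
Proof. by move=> f h; rewrite /cls raddfB. Qed.

HB.instance Definition _ :=
  GRing.isZmodMorphism.Build smooth smooth_mod cls cls_is_zmod_morphism.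

Definition smooth_mod_scale (k : R) (q : smooth_mod) : smooth_mod :=
  cls (k *: repr q).

Lemma smooth_mod_scale_cls k f : smooth_mod_scale k (cls f) = cls (k *: f).
Proof.
apply/cls_eqP; have /cls_eqP[c fc] : cls (repr (cls f)) = cls f.
  by rewrite /cls reprK.
by exists (k * c) => p; rewrite -(fc p) mulrBr.
Qed.

Lemma cls_surj q : exists f, q = cls f.
Proof. by exists (repr q); rewrite /cls reprK. Qed.

Fact smooth_mod_scaleA a b q :
  smooth_mod_scale a (smooth_mod_scale b q) = smooth_mod_scale (a * b) q.
Proof. by have [f ->] := cls_surj q; rewrite !smooth_mod_scale_cls scalerA. Qed.

Fact smooth_mod_scale1 : left_id 1 smooth_mod_scale.
Proof.
by move=> q; have [f ->] := cls_surj q; rewrite smooth_mod_scale_cls scale1r.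
Qed.

Fact smooth_mod_scaleDr : right_distributive smooth_mod_scale +%R.
Proof.
move=> k q r; have [f ->] := cls_surj q; have [h ->] := cls_surj r.
rewrite -(raddfD cls) !smooth_mod_scale_cls -(raddfD cls).
by rewrite scalerDr.
Qed.

Fact smooth_mod_scaleDl q :
  {morph smooth_mod_scale^~ q : a b / a + b}.
Proof.
move=> a b; have [f ->] := cls_surj q.
by rewrite !smooth_mod_scale_cls -(raddfD cls) scalerDl.
Qed.

HB.instance Definition _ := GRing.Zmodule_isLmodule.Build R smooth_mod
  smooth_mod_scaleA smooth_mod_scale1 smooth_mod_scaleDr smooth_mod_scaleDl.

End SmoothFunctions.

(** * The density manifold *)

Section DensityManifold.
Context {R : realType} {n : nat} {M : ptopologicalType}.
Variables (A : smooth_atlas R n M) (mu : {measure set (borel M) -> \bar R}).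

Definition vol_integral (u : M -> R) : R := (\int[mu]_(p in [set: M]) u p)%R.

Definition density_pred : {pred smooth A} := fun r =>
  `[< (forall p, 0 < r p) /\ vol_integral r = 1 >].

Record density := Density {
  density_val :> smooth A;
  density_valP : density_val \in density_pred
}.

HB.instance Definition _ := [isSub for density_val].
HB.instance Definition _ := [Choice of density by <:].

Definition tangent : set (smooth A) := [set a | vol_integral a = 0].

Record onsager := Onsager {
  onsager_op :> density -> {linear smooth_mod A -> smooth A};
  onsager_bij : forall r,
    set_bij [set: smooth_mod A] tangent (onsager_op r);
  onsager_selfadjoint : forall r (f h : smooth A),
    vol_integral (fun p => f p * onsager_op r (cls h) p) =
    vol_integral (fun p => onsager_op r (cls f) p * h p);
  onsager_posdef : forall r (f : smooth A), cls f != 0 ->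
    0 < vol_integral (fun p => f p * onsager_op r (cls f) p)
}.

(* The inverse of [phi r], meaningful for [a] in [tangent]. *)
Definition onsager_inv (phi : onsager) (r : density) (a : smooth A) :
    smooth_mod A :=
  xget 0 [set q | phi r q = a].

(* The curve [c], considered on the interval [J] only, has velocity [a] at [t]
   in the Frechet topology; one-sided at an endpoint belonging to [J]. *)
Definition has_velocity (J : interval R) (c : R -> density) (t : R)
    (a : smooth A) : Prop :=
  smooth_cvg (within [set h | t + h \in J] 0^')
    (fun h => h^-1 *: (val (c (t + h)) - val (c t))) a.

Definition is_dual_geodesic (phi : onsager) (r : density) (a : smooth A)
    (J : interval R) (c : R -> density) : Prop :=
  c 0 = r /\
  forall t, t \in J -> has_velocity J c t (phi (c t) (onsager_inv phi r a)).

(* On a compact manifold [r + t s] is a density for small [t], so the default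
   value of [insubd] plays no role in the derivative at [0]. *)
Definition is_variation (E : density -> R) (r : density) (f : smooth A) :
    Prop :=
  forall s, tangent s ->
    is_derive (0 : R) 1 (fun t => E (insubd r (val r + t *: s)))
      (vol_integral (fun p => f p * s p)).

Definition has_first_variation (E : density -> R) (r : density) : Prop :=
  exists f, is_variation E r f.

(* The class is unique when it exists, [mu] having full support; [0] is a
   dummy value otherwise. *)
Definition first_variation (E : density -> R) (r : density) : smooth_mod A :=
  xget 0 [set cls f | f in is_variation E r].

Definition gradient (phi : onsager) (E : density -> R) (r : density) :
    smooth A :=
  phi r (first_variation E r).

Definition is_gradient_flow (phi : onsager) (E : density -> R)
    (J : interval R) (c : R -> density) : Prop :=
  forall t, t \in J ->
    has_first_variation E (c t) /\
    has_velocity J c t (- gradient phi E (c t)).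

Definition potential_energy (f : smooth A) (r : density) : R :=
  - vol_integral (fun p => f p * r p).

End DensityManifold.

(* Main.v *)
Require Import Defs.
From HB Require Import structures.
From mathcomp Require Import all_boot all_order all_algebra.
From mathcomp Require Import all_classical all_reals all_analysis.
From mathcomp Require Import measurable_realfun.

Set Implicit Arguments.
Unset Strict Implicit.
Unset Printing Implicit Defensive.

Import Order.TTheory GRing.Theory Num.Theory.
Import numFieldNormedType.Exports.

Local Open Scope classical_set_scope.
Local Open Scope ring_scope.

(** The potential energy is affine in the density:
    [- ∫ f (r + t s) = - ∫ f r + t ∫ (- f) s].  Its first variation is therefore
    the class of [- f] at every density, and its gradient at [r] is
    [- phi r (cls f)].  Along the dual geodesic the covector
    [onsager_inv phi rho a] is constant, equal to [cls f] because [phi rho] is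
    injective, so the geodesic equation [gamma' = phi gamma (cls f)] is
    literally the descent equation [gamma' = - grad].

    The work lies in justifying these formulas.
    - Integrals have to be additive.  A density is continuous and positive on a
      compact space, hence bounded below by some [m > 0]; having integral [1] it
      forces the total mass to be at most [1 / m]
      ([density_finite_measure]), after which every continuous function is
      integrable.
    - The energy at [r + t s] has to be meaningful for small [t]: the bound
      [m] again leaves room for a bounded perturbation ([near0_density]).
    - The class of the first variation has to be unique.  If [f] and [h] both
      represent it, testing against the tangent vector [phi r (cls (f - h))]
      gives [∫ (f - h) phi r (cls (f - h)) = 0], and positive definiteness
      forces [cls f = cls h] ([is_variation_cls]). *)

Lemma continuous_borel_measurable (R : realType) (M : ptopologicalType)
    (u : M -> R) :
  continuous u -> measurable_fun [set: borel M] (u : borel M -> R).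
Proof.
move=> /continuousP cu.
apply: (measurability _ (RGenOInfty.measurableE R)) => _ [_ [x ->] <-].
by rewrite setTI; apply: sub_sigma_algebra; exact: cu.
Qed.

Lemma continuous_compact_bounded (R : realType) (M : ptopologicalType)
    (u : M -> R) :
  compact [set: M] -> continuous u -> exists K : R, forall p, `|u p| <= K.
Proof.
move=> cM cu.
have cnu : {within [set: M], continuous (fun p => `|u p|)}.
  apply: continuous_subspaceT => p.
  by apply: continuous_comp; [exact: cu | exact: norm_continuous].
have [|c _ cmax] := compact_EVT_max _ cM cnu; first by exists point.
by exists `|u c| => p; apply: cmax; rewrite inE.
Qed.

Lemma continuous_compact_gt0 (R : realType) (M : ptopologicalType)
    (u : M -> R) :
  compact [set: M] -> continuous u -> (forall p, 0 < u p) ->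
  exists2 m : R, 0 < m & forall p, m <= u p.
Proof.
move=> cM cu u_gt0.
have [||c _ cmin] := @compact_EVT_min _ _ u _ _ cM.
- by exists point.
- exact: continuous_subspaceT.
by exists (u c) => // p; apply: cmin; rewrite inE.
Qed.

(** Near a point of the domain of a chart, [f] is its coordinate expression
    composed with the chart. *)
Lemma smooth_continuous (R : realType) (n : nat) (M : topologicalType)
    (A : smooth_atlas R n M) (f : smooth A) : continuous f.
Proof.
move=> p; have [i ip] := atlas_cover A p.
have /asboolP/(_ i [::] (A i p))[|cf _] := smooth_valP f; first by exists p.
have : {for p, continuous ((f \o chart_inv (A i)) \o A i)}.
  by apply: continuous_comp; [exact: chart_map_continuous | exact: cf].
apply: near_eq_continuous.
have := open_nbhs_nbhs (conj (@open_chart_dom _ _ _ (A i)) ip).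
by apply: filterS => q iq /=; rewrite chart_mapK.
Qed.

(** A density is bounded below by a constant [m > 0], so
    [m * mu M <= ∫ r = 1]. *)
Lemma density_finite_measure (R : realType) (n : nat) (M : ptopologicalType)
    (A : smooth_atlas R n M) (mu : {measure set (borel M) -> \bar R})
    (r : density A mu) :
  compact [set: M] -> (mu [set: borel M] < +oo)%E.
Proof.
move=> cM; have /asboolP[r_gt0 r1] := density_valP r.
have cr := @smooth_continuous _ _ _ _ (density_val r).
have [m m_gt0 mr] := continuous_compact_gt0 cM cr r_gt0.
have mfr := continuous_borel_measurable cr.
have int_r : (\int[mu]_p (r p)%:E < +oo)%E.
  (* An infinite integral would be read as [fine +oo = 0], not [1]. *)
  rewrite ltey; apply/eqP => roo; move: r1.
  by rewrite /vol_integral /Rintegral roo => /eqP; rewrite eq_sym oner_eq0.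
have : (m%:E * mu [set: borel M] < +oo)%E.
  apply: le_lt_trans int_r; rewrite -integral_cst//.
  apply: ge0_le_integral => //=.
  - by move=> p _; rewrite lee_fin ltW.
  - exact/measurable_EFinP.
  - by move=> p _; rewrite lee_fin.
by rewrite !ltey; apply: contraNN => /eqP ->; rewrite gt0_muley.
Qed.

Lemma continuous_integrable (R : realType) (M : ptopologicalType)
    (mu : {measure set (borel M) -> \bar R}) (u : M -> R) :
  compact [set: M] -> (mu [set: borel M] < +oo)%E -> continuous u ->
  mu.-integrable [set: borel M] (EFin \o u).
Proof.
move=> cM muoo cu; apply: measurable_bounded_integrable => //.
  exact: continuous_borel_measurable.
have [K uK] := continuous_compact_bounded cM cu.
exists K; split=> [|x Kx p _]; first exact: num_real.
exact/ltW/(le_lt_trans (uK p)).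
Qed.

Lemma vol_integral_lin (R : realType) (M : ptopologicalType)
    (mu : {measure set (borel M) -> \bar R}) (u v : M -> R) (k : R) :
  compact [set: M] -> (mu [set: borel M] < +oo)%E ->
  continuous u -> continuous v ->
  vol_integral mu (fun p => u p + k * v p) =
  vol_integral mu u + k * vol_integral mu v.
Proof.
move=> cM muoo cu cv.
have ckv : continuous (fun p => k * v p).
  by move=> p; apply: continuousM; [exact: cst_continuous | exact: cv].
rewrite /vol_integral -RintegralZl//; last exact: continuous_integrable.
by rewrite -RintegralD//; exact: continuous_integrable.
Qed.

Lemma smooth_mul_continuous (R : realType) (n : nat) (M : topologicalType)
    (A : smooth_atlas R n M) (f h : smooth A) :
  continuous (fun p => f p * h p).
Proof. by move=> p; apply: continuousM; exact: smooth_continuous. Qed.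

Section FirstVariation.
Context {R : realType} {n : nat} {M : ptopologicalType}.
Context {A : smooth_atlas R n M} {mu : {measure set (borel M) -> \bar R}}.

(** The total mass of [r + t s] is that of [r] because [s] has zero mean, and
    positivity survives as long as [|t| (K + 1) < m], where [K] bounds [|s|] and
    [m > 0] bounds [r] from below; [K] itself may be [0]. *)
Lemma near0_density (r : density A mu) (s : smooth A) :
  compact [set: M] -> tangent mu s ->
  \forall t \near (0 : R), val r + t *: s \in density_pred mu.
Proof.
move=> M_compact s0; have /asboolP[r_gt0 r1] := density_valP r.
have cr := @smooth_continuous _ _ _ _ (density_val r).
have [m m_gt0 mr] := continuous_compact_gt0 M_compact cr r_gt0.
have [K sK] := continuous_compact_bounded M_compact
  (@smooth_continuous _ _ _ _ s).
have K1_gt0 : 0 < K + 1.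
  by rewrite ltr_wpDl// (le_trans _ (sK point)).
near=> t; apply/asboolP; split=> [p|].
  have : `|t * s p| < m.
    rewrite normrM; apply: (@le_lt_trans _ _ (`|t| * (K + 1))).
      by rewrite ler_wpM2l// (le_trans (sK p))// lerDl.
    rewrite -ltr_pdivlMr//; near: t; apply: (@nbhs0_lt _ R^o); exact: divr_gt0.
  rewrite ltr_norml => /andP[tsm _].
  rewrite -(subrr m) (_ : (val r + t *: s) p = r p + t * s p)//.
  by rewrite ler_ltD.
have -> : (val r + t *: s : M -> R) = (fun p => r p + t * s p) by [].
have muoo := density_finite_measure r M_compact.
rewrite vol_integral_lin//; last exact: smooth_continuous.
by rewrite [vol_integral mu s]s0 mulr0 addr0.
Unshelve. all: by end_near. Qed.

(** For small [t] the perturbation [r + t s] is itself a density, so the energy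
    agrees near [t = 0] with the affine function [t |-> - (∫ f r + t ∫ f s)]. *)
Lemma potential_energy_is_variation (f : smooth A) (r : density A mu) :
  compact [set: M] -> is_variation (potential_energy f) r (- f).
Proof.
move=> M_compact s s0; have muoo := density_finite_measure r M_compact.
have lin (g h h' : smooth A) (k : R) :
    vol_integral mu (fun p => g p * (h + k *: h') p) =
    vol_integral mu (fun p => g p * h p) +
    k * vol_integral mu (fun p => g p * h' p).
  rewrite -vol_integral_lin//; try exact: smooth_mul_continuous.
  congr vol_integral; apply/funext => p.
  by rewrite (_ : (h + k *: h') p = h p + k * h' p)// mulrDr mulrCA.
pose b := vol_integral mu (fun p => f p * s p).
have -> : vol_integral mu (fun p => (- f) p * s p) = - b.
  rewrite /b /vol_integral -mulN1r -RintegralZl//; last first.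
    by apply: continuous_integrable => //; exact: smooth_mul_continuous.
  by congr Rintegral; apply/funext => p; rewrite mulN1r -mulNr.
pose c := vol_integral mu (fun p => f p * r p).
apply: (@near_eq_is_derive _ _ _ (fun t : R => - (c + t * b))).
  have := near0_density r M_compact s0; apply: filterS => t rts.
  by rewrite /potential_energy insubdK// lin.
apply: is_derive_eq; rewrite add0r.
by rewrite scaler0 add0r mul1r; congr (- _); exact: mulr1.
Qed.

(** Uniqueness of the first variation modulo constants.  The Onsager operator
    provides the test function: [phi r (cls (f - h))] is tangent, and pairs
    positively with [f - h] unless [f - h] is constant. *)
Lemma is_variation_cls (phi : onsager A mu) (E : density A mu -> R)
    (r : density A mu) (f h : smooth A) :
  compact [set: M] -> is_variation E r f -> is_variation E r h -> cls f = cls h.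
Proof.
move=> M_compact Ef Eh; apply/eqP; rewrite -subr_eq0 -raddfB.
apply/negPn/negP => fh0.
pose s := phi r (cls (f - h)).
have s0 : tangent mu s by have [+ _ _] := onsager_bij phi r; apply.
have := onsager_posdef phi r fh0; rewrite -/s.
have fhs : vol_integral mu (fun p => f p * s p) =
           vol_integral mu (fun p => h p * s p).
  by have [_ <-] := Ef s s0; have [_ <-] := Eh s s0.
have -> : (fun p => (f - h) p * s p) =
          (fun p => f p * s p + (-1) * (h p * s p)).
  by apply/funext => p; rewrite mulN1r -mulrBl.
have muoo := density_finite_measure r M_compact.
rewrite vol_integral_lin//; try exact: smooth_mul_continuous.
by rewrite fhs mulN1r subrr ltxx.
Qed.

Lemma first_variationE (phi : onsager A mu) (E : density A mu -> R)
    (r : density A mu) (f : smooth A) :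
  compact [set: M] -> is_variation E r f -> first_variation E r = cls f.
Proof.
move=> M_compact Ef; apply: xget_unique; first by exists f.
by move=> _ [h Eh <-]; exact: (is_variation_cls phi M_compact Eh Ef).
Qed.

Lemma gradient_potential_energy (phi : onsager A mu) (f : smooth A)
    (r : density A mu) :
  compact [set: M] -> gradient phi (potential_energy f) r = - phi r (cls f).
Proof.
move=> M_compact; rewrite /gradient.
rewrite (first_variationE phi M_compact (potential_energy_is_variation f r _))//.
by rewrite !raddfN.
Qed.

End FirstVariation.

Lemma onsager_invK (R : realType) (n : nat) (M : ptopologicalType)
    (A : smooth_atlas R n M) (mu : {measure set (borel M) -> \bar R})
    (phi : onsager A mu) (r : density A mu) (q : smooth_mod A) :
  onsager_inv phi r (phi r q) = q.
Proof.
apply: xget_unique => // q' qq'.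
by have [_ /(_ q' q) + _] := onsager_bij phi r; apply; rewrite ?inE.
Qed.

Theorem theorem2p9 (R : realType) (n : nat) (M : ptopologicalType)
    (A : smooth_atlas R n M) (g : riemannian_metric A)
    (mu : {measure set (borel M) -> \bar R})
    (M_compact : compact [set: M]) (M_hausdorff : hausdorff_space M)
    (mu_volume : is_volume_measure g mu)
    (phi : onsager A mu) (rho : density A mu)
    (a f : smooth A) (a_tangent : tangent mu a)
    (a_f : a = phi rho (cls f))
    (J : interval R) (J0 : 0 \in J) (J_nontrivial : exists2 t, t \in J & t != 0)
    (gamma : R -> density A mu) :
  is_dual_geodesic phi rho a J gamma ->
  gamma 0 = rho /\ is_gradient_flow phi (potential_energy f) J gamma.
Proof.
move=> [gamma0 geo]; split=> // t tJ; split.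
  by exists (- f); exact: potential_energy_is_variation.
rewrite gradient_potential_energy// opprK.
by have := geo t tJ; rewrite a_f onsager_invK.
Qed.
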